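(* Let $K$ be a field, let $P$ be a finite distributive lattice and let $A$ be the ASL on $P$ over $K$ given by the Hibi relations. Then the second Veronese algebra $A^{(2)}=\bigoplus_{i\ge0}A_{2i}$ is an ASL on $Z_2(P)$ over $K$ with the following structure: the vertices of $Z_2(P)$ are the standard monomials of degree $2$ in $A$ (the element $(\alpha,\beta)\in Z_2(P)$, $\alpha\le\beta$, being identified with the product $\alpha\beta\in A_2$), and the straightening laws are $$(\alpha\beta)(\gamma\delta)=\big[(\alpha\wedge\gamma)(\beta\vee\delta)\big]\Big[\big((\alpha\wedge\delta)\vee(\beta\wedge\gamma)\big)\big((\alpha\vee\delta)\wedge(\beta\vee\gamma)\big)\Big]$$ for all $\alpha,\beta,\gamma,\delta\in P$ with $\alpha\le\beta$, $\gamma\le\delta$ and such that $\alpha\beta$ and $\gamma\delta$ are incomparable in $Z_2(P)$.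
   Context: All posets are finite. **ASL.** Let $A$ be a $K$-algebra and $P\subset A$ a finite poset. A product $\alpha_1\cdots\alpha_t$ with $\alpha_i\in P$ is a monomial; it is standard if $\alpha_1\le\cdots\le\alpha_t$. $A$ is a (graded) algebra with straightening laws (ASL) on $P$ over $K$ if: (ASL 0) $A=\bigoplus_{i\ge0}A_i$ is a graded $K$-algebra with $A_0=K$, the elements of $P$ are homogeneous of positive degree and generate $A$ as a $K$-algebra; (ASL 1) the standard monomials form a $K$-basis of $A$; (ASL 2) if $\alpha,\beta\in P$ are incomparable and $\alpha\beta=\sum_i r_i\gamma_{i1}\cdots\gamma_{it_i}$, with $0\ne r_i\in K$ and $\gamma_{i1}\le\cdots\le\gamma_{it_i}$, is the unique expression as a linear combination of standard monomials (possibly $0$), then $\gamma_{i1}<\alpha$ and $\gamma_{i1}<\beta$ for every $i$. The relations in (ASL 2) are called the straightening laws of $A$. **Hibi ring.** For a finite distributive lattice $P$ with meet $\wedge$ and join $\vee$, the ASL on $P$ given by the Hibi relations is the $K$-algebra $A$ generated by the elements of $P$ (as degree $1$ variables) modulo the relations $\alpha\beta=(\alpha\wedge\beta)(\alpha\vee\beta)$ for all incomparable $\alpha,\beta\in P$. (It is known, by Hibi, that this is an ASL on $P$.) The same letters denote elements of $P$ and their classes in $A$; juxtaposition denotes the product in $A$. **Veronese algebra.** $A^{(2)}$ is graded by $(A^{(2)})_i=A_{2i}$. **Zig-zag poset.** $Z_2(P)=\{(\alpha_1,\alpha_2):\alpha_1,\alpha_2\in P,\ \alpha_1\le\alpha_2\}$,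 with $(\alpha_1,\alpha_2)\le(\beta_1,\beta_2)$ if and only if $\alpha_1\le\beta_1$ and $\alpha_2\ge\beta_2$. *)

(* Defs.v *)
From HB Require Import structures.
From mathcomp Require Import all_boot all_order all_algebra.
From mathcomp Require Import boolp mpoly.

Set Implicit Arguments.
Unset Strict Implicit.
Unset Printing Implicit Defensive.

Import Order.TTheory GRing.Theory.

Local Open Scope ring_scope.
Local Open Scope quotient_scope.

Section Grading.
Context (K : fieldType) (A : comAlgType K).

(* [gr i] is the homogeneous component of degree i; the last two clauses say
   that A is the internal direct sum of its components. *)
Definition is_grading (gr : nat -> {pred A}) : Prop :=
  [/\ forall i, submod_closed (gr i),
      1 \in gr 0%N,
      forall i j x y, x \in gr i -> y \in gr j -> x * y \in gr (i + j)%N,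
      forall x, exists n (f : nat -> A),
        (forall i, f i \in gr i) /\ x = \sum_(i < n) f i
    & forall n (f : nat -> A), (forall i, f i \in gr i) ->
        \sum_(i < n) f i = 0 -> forall i, (i < n)%N -> f i = 0].

End Grading.

Section ASL.
Context (K : fieldType) (d : Order.disp_t) (Q : finPOrderType d).
Context (A : comAlgType K) (gr : nat -> {pred A}) (e : Q -> A).

(* Monomials are indexed by sequences over Q; the sorted ones are the
   standard monomials, the empty sequence standing for 1. *)
Definition monomial (s : seq Q) : A := \prod_(q <- s) e q.
Definition standard (s : seq Q) : bool := sorted <=%O s.

Definition lincomb (S : seq (seq Q)) (c : seq Q -> K) : A :=
  \sum_(s <- S) c s *: monomial s.

Definition standard_monomials_basis : Prop :=
  (forall x : A, exists S c, [/\ uniq S, all standard S & x = lincomb S c]) /\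
  (forall S c, uniq S -> all standard S -> lincomb S c = 0 ->
     {in S, forall s, c s = 0}).

Definition standard_expression (x : A) (S : seq (seq Q)) (c : seq Q -> K) : Prop :=
  [/\ uniq S, all standard S, {in S, forall s, c s != 0} & x = lincomb S c].

(* The map e plays the role of the inclusion of Q in A. *)
Definition is_ASL : Prop :=
  [/\ injective e,
      [/\ is_grading gr,
          forall x, x \in gr 0%N <-> exists k : K, x = k%:A,
          forall q, exists2 i, (0 < i)%N & e q \in gr i
        & forall B : {pred A}, subalg_closed B -> (forall q, e q \in B) ->
            forall x, x \in B],
      standard_monomials_basis
    & forall a b : Q, ~~ (a >=< b)%O ->
        forall S c, standard_expression (e a * e b) S c ->
        {in S, forall s, exists g t, [/\ s = g :: t, (g < a)%O & (g < b)%O]}].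

(* For incomparable a and b, the straightening law of e a * e b in an ASL is
   its standard expression. *)
Definition straightening_law (a b : Q) (S : seq (seq Q)) (c : seq Q -> K) : Prop :=
  ~~ (a >=< b)%O /\ standard_expression (e a * e b) S c.

End ASL.

Section Veronese.
Context (K : fieldType) (A : comAlgType K) (gr : nat -> {pred A}).
Hypothesis gr_grading : is_grading gr.

Definition veronese2_pred : {pred A} := fun x =>
  `[< exists n (f : nat -> A),
        (forall i, f i \in gr (2 * i)%N) /\ x = \sum_(i < n) f i >].

Lemma gr_scaleD i k x y : x \in gr i -> y \in gr i -> k *: x + y \in gr i.
Proof. by case: gr_grading => h _ _ _ _ xi yi; case: (h i) => _; apply. Qed.

Lemma gr_0 i : 0 \in gr i.
Proof. by case: gr_grading => h _ _ _ _; case: (h i). Qed.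

Lemma gr_D i x y : x \in gr i -> y \in gr i -> x + y \in gr i.
Proof. by move=> xi yi; rewrite -[x]scale1r gr_scaleD. Qed.

Lemma gr_veronese2 i x : x \in gr (2 * i)%N -> x \in veronese2_pred.
Proof.
move=> xi; apply/asboolP; exists i.+1, (fun j => if j == i then x else 0).
split=> [j|]; first by case: eqP => [->|] //; rewrite gr_0.
by rewrite big_ord_recr /= eqxx big1 ?add0r // => j _; rewrite ltn_eqF.
Qed.

Lemma veronese2_linear : linear_closed veronese2_pred.
Proof.
move=> k x y /asboolP[n [f [fg ->]]] /asboolP[m [g [gg ->]]]; apply/asboolP.
pose cut N (h : nat -> A) i : A := if (i < N)%N then h i else 0.
have cutE N M (h : nat -> A) : (N <= M)%N ->
    \sum_(i < N) h i = \sum_(i < M) cut N h i.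
  by move=> NM; rewrite (big_ord_widen M h NM) big_mkcond.
exists (maxn n m), (fun i => k *: cut n f i + cut m g i); split=> [i|].
  by apply: gr_scaleD; rewrite /cut; case: ifP => // _; rewrite gr_0.
rewrite big_split /= -scaler_sumr.
by rewrite (cutE n (maxn n m)) ?leq_maxl // (cutE m (maxn n m)) ?leq_maxr.
Qed.

Lemma veronese2_0 : 0 \in veronese2_pred.
Proof. by apply: (@gr_veronese2 0); rewrite gr_0. Qed.

Lemma veronese2_sum n (f : 'I_n -> A) :
  (forall i, f i \in veronese2_pred) -> \sum_(i < n) f i \in veronese2_pred.
Proof.
move=> h; elim/big_ind: _ => [|x y xv yv|i _]; [exact: veronese2_0| |exact: h].
by rewrite -[x]scale1r veronese2_linear.
Qed.

Lemma veronese2_subalg : subalg_closed veronese2_pred.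
Proof.
split; first by apply: (@gr_veronese2 0); case: gr_grading.
- exact: veronese2_linear.
- move=> x y /asboolP[n [f [fg ->]]] /asboolP[m [g [gg ->]]].
  rewrite mulr_suml; apply: veronese2_sum => i.
  rewrite mulr_sumr; apply: veronese2_sum => j.
  apply: (@gr_veronese2 (i + j)); rewrite mulnDr.
  by case: gr_grading => _ _ h _ _; apply: h.
Qed.

End Veronese.

(* The second Veronese algebra, as a subalgebra of A.  The proof that [gr] is
   a grading is a parameter because the algebra structure depends on it. *)
Record veronese2 (K : fieldType) (A : comAlgType K) (gr : nat -> {pred A})
    (gr_grading : is_grading gr) := Veronese2 {
  veronese2_val : A;
  veronese2_valP : veronese2_val \in veronese2_pred gr
}.

Section VeroneseAlgebra.
Context (K : fieldType) (A : comAlgType K) (gr : nat -> {pred A}).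
Context (gr_grading : is_grading gr).

Local Notation V := (veronese2 gr_grading).
HB.instance Definition _ := [isSub for @veronese2_val K A gr gr_grading].
HB.instance Definition _ := [Choice of V by <:].
HB.instance Definition _ :=
  GRing.SubChoice_isSubComNzRing.Build A (veronese2_pred gr) V
    (GRing.subalg_closedBM (veronese2_subalg gr_grading)).
HB.instance Definition _ :=
  GRing.SubZmodule_isSubLmodule.Build K A (veronese2_pred gr) V
    (GRing.subalg_closedZ (veronese2_subalg gr_grading)).
HB.instance Definition _ := [SubNzRing_SubLmodule_isSubLalgebra of V by <:].
HB.instance Definition _ := [SubLalgebra_isSubAlgebra of V by <:].

Definition veronese2_gr (i : nat) : {pred V} :=
  fun x => veronese2_val x \in gr (2 * i)%N.

End VeroneseAlgebra.

Section HibiIdeal.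
Context (K : fieldType) (d : Order.disp_t) (P : finDistrLatticeType d).

Local Notation S := {mpoly K[#|P|]}.

Definition hibi_var (a : P) : S := 'X_(enum_rank a).

Definition hibi_rel (a b : P) : S :=
  hibi_var a * hibi_var b - hibi_var (a `&` b)%O * hibi_var (a `|` b)%O.

Definition hibi_ideal : {pred S} := fun p =>
  `[< exists c : P -> P -> S,
        p = \sum_(a : P) \sum_(b : P | ~~ (a >=< b)%O) c a b * hibi_rel a b >].

Lemma hibi_ideal_closed : idealr_closed hibi_ideal.
Proof.
split.
- apply/asboolP; exists (fun _ _ => 0).
  by rewrite big1 // => a _; rewrite big1 // => b _; rewrite mul0r.
- have rel0 a b : (hibi_rel a b).@[fun=> 1] = 0.
    by rewrite mevalB !mevalM !mevalXU subrr.
  apply/asboolP => -[c /(congr1 (meval (fun=> 1)))] /eqP.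
  rewrite meval1 raddf_sum big1 ?oner_eq0 // => a _.
  by rewrite raddf_sum big1 // => b _; rewrite /= mevalM rel0 mulr0.
- move=> r p q /asboolP[c ->] /asboolP[e ->]; apply/asboolP.
  exists (fun a b => r * c a b + e a b).
  rewrite mulr_sumr -big_split; apply: eq_bigr => a _.
  rewrite mulr_sumr -big_split; apply: eq_bigr => b _.
  by rewrite mulrDl mulrA.
Qed.

HB.instance Definition _ := isIdealr.Build S hibi_ideal hibi_ideal_closed.

Lemma hibi_rel_homog a b : hibi_rel a b \is 2.-homog.
Proof.
have h x : hibi_var x \is 1.-homog by rewrite dhomogX; apply/eqP/mdeg1.
by rewrite rpredB // (dhomogM (h _) (h _)).
Qed.

Lemma hibi_ideal_pihomog j p : p \in hibi_ideal -> pihomog mdeg j p \in hibi_ideal.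
Proof.
move=> /asboolP[c ->]; apply/asboolP.
exists (fun a b => \sum_(i < mmeasure mdeg (c a b))
  if (i + 2 == j)%N then pihomog mdeg i (c a b) else 0).
rewrite raddf_sum; apply: eq_bigr => a _.
rewrite raddf_sum; apply: eq_bigr => b _.
rewrite {1}(pihomog_partitionE (leqnn (mmeasure mdeg (c a b)))).
rewrite !mulr_suml raddf_sum; apply: eq_bigr => i _ /=.
have hi := dhomogM (pihomogP mdeg i (c a b)) (hibi_rel_homog a b).
case: eqP => [<-|/eqP ne]; first by rewrite pihomog_dE.
by rewrite mul0r (pihomog_ne0 ne hi).
Qed.

Definition hibi := {ideal_quot hibi_ideal}.

HB.instance Definition _ := GRing.ComNzRing.on hibi.

Definition hibi_pi (p : S) : hibi := \pi_{ideal_quot hibi_ideal} p.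

Lemma hibi_pi_zmod : zmod_morphism hibi_pi.
Proof. by move=> p q; rewrite /hibi_pi rmorphB. Qed.

Lemma hibi_pi_monoid : monoid_morphism hibi_pi.
Proof. by split=> [|p q]; rewrite /hibi_pi (rmorph1, rmorphM). Qed.

HB.instance Definition _ :=
  GRing.isZmodMorphism.Build S hibi hibi_pi hibi_pi_zmod.
HB.instance Definition _ :=
  GRing.isMonoidMorphism.Build S hibi hibi_pi hibi_pi_monoid.

Definition hibi_scale (k : K) (x : hibi) : hibi := hibi_pi k%:MP * x.

Lemma hibi_scaleA a b v : hibi_scale a (hibi_scale b v) = hibi_scale (a * b) v.
Proof. by rewrite /hibi_scale mulrA -rmorphM mpolyCM. Qed.

Lemma hibi_scale1 : left_id 1 hibi_scale.
Proof. by move=> v; rewrite /hibi_scale rmorph1 mul1r. Qed.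

Lemma hibi_scaleDr : right_distributive hibi_scale +%R.
Proof. by move=> a u v; rewrite /hibi_scale mulrDr. Qed.

Lemma hibi_scaleDl v : {morph hibi_scale^~ v : a b / a + b}.
Proof. by move=> a b; rewrite /hibi_scale mpolyCD rmorphD mulrDl. Qed.

HB.instance Definition _ := GRing.Zmodule_isLmodule.Build K hibi
  hibi_scaleA hibi_scale1 hibi_scaleDr hibi_scaleDl.

Lemma hibi_scaleAl k (u v : hibi) : k *: (u * v) = (k *: u) * v.
Proof. exact: mulrA. Qed.

HB.instance Definition _ := GRing.Lmodule_isLalgebra.Build K hibi hibi_scaleAl.
HB.instance Definition _ := GRing.Lalgebra_isComAlgebra.Build K hibi.

Lemma hibi_piZ k p : hibi_pi (k *: p) = k *: hibi_pi p.
Proof. by rewrite -mul_mpolyC rmorphM. Qed.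

Lemma hibi_pi_surj x : exists p, x = hibi_pi p.
Proof. by exists (repr x); rewrite /hibi_pi reprK. Qed.

Lemma hibi_pi_eq0 p : (hibi_pi p == 0) = (p \in hibi_ideal).
Proof. by rewrite -[0](rmorph0 hibi_pi) -Quotient.idealrBE subr0. Qed.

Definition hibi_gen (a : P) : hibi := hibi_pi (hibi_var a).

Definition hibi_gr (i : nat) : {pred hibi} := fun x =>
  `[< exists2 p : S, p \is i.-homog & x = hibi_pi p >].

Lemma hibi_grading : is_grading hibi_gr.
Proof.
split.
- move=> i; split; first by apply/asboolP; exists 0; rewrite ?rpred0 ?rmorph0.
  move=> k _ _ /asboolP[p hp ->] /asboolP[q hq ->]; apply/asboolP.
  by exists (k *: p + q); rewrite ?rpredD ?rpredZ // rmorphD /= hibi_piZ.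
- by apply/asboolP; exists 1; rewrite ?dhomog1 ?rmorph1.
- move=> i j _ _ /asboolP[p hp ->] /asboolP[q hq ->]; apply/asboolP.
  by exists (p * q); rewrite ?rmorphM // dhomogM.
- move=> x; have [p ->] := hibi_pi_surj x.
  exists (mmeasure mdeg p), (fun i => hibi_pi (pihomog mdeg i p)); split=> [i|].
    by apply/asboolP; exists (pihomog mdeg i p); rewrite ?pihomogP.
  by rewrite -raddf_sum -pihomog_partitionE.
- move=> n f hf; have /choice[g hg] i :
      exists p : S, p \is i.-homog /\ f i = hibi_pi p.
    by have /asboolP[p] := hf i; exists p.
  move=> sum0 i lt_in; apply/eqP; rewrite (hg i).2 hibi_pi_eq0.
  have /hibi_ideal_pihomog : \sum_(j < n) g j \in hibi_ideal.
    rewrite -hibi_pi_eq0 raddf_sum -[X in _ == X]sum0; apply/eqP.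
    by apply: eq_bigr => j _; rewrite (hg j).2.
  move=> /(_ i); rewrite raddf_sum (bigD1 (Ordinal lt_in)) //= big1 ?addr0.
    by rewrite pihomog_dE // (hg i).1.
  move=> j ne; rewrite (@pihomog_ne0 _ _ _ j) ?(hg j).1 //.
Qed.

End HibiIdeal.

Arguments hibi K {d} P.
Arguments hibi_gr K {d} P i.
Arguments hibi_grading K {d} P.
Arguments hibi_gen K {d P} a.

Record zigzag2 (d : Order.disp_t) (P : finPOrderType d) := Zigzag2 {
  zigzag2_val : P * P;
  zigzag2_le : (zigzag2_val.1 <= zigzag2_val.2)%O
}.

Fact zigzag2_display : Order.disp_t -> Order.disp_t. Proof. exact: id. Qed.

Section Zigzag2.
Context (d : Order.disp_t) (P : finPOrderType d).

HB.instance Definition _ := [isSub for @zigzag2_val d P].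
HB.instance Definition _ := [Finite of zigzag2 P by <:].

Definition zle (x y : zigzag2 P) : bool :=
  ((val x).1 <= (val y).1)%O && ((val y).2 <= (val x).2)%O.

Lemma zle_refl : reflexive zle.
Proof. by move=> x; rewrite /zle !lexx. Qed.

Lemma zle_anti : antisymmetric zle.
Proof.
move=> x y /andP[/andP[h1 h2] /andP[h3 h4]]; apply/val_inj/eqP.
by rewrite -pair_eqE /= !eq_le h1 h2 h3 h4.
Qed.

Lemma zle_trans : transitive zle.
Proof.
move=> y x z /andP[h1 h2] /andP[h3 h4].
by rewrite /zle (le_trans h1 h3) (le_trans h4 h2).
Qed.

HB.instance Definition _ := Order.Le_isPOrder.Build (zigzag2_display d)
  (zigzag2 P) zle_refl zle_anti zle_trans.

Definition zz (a b : P) (ab : (a <= b)%O) : zigzag2 P := @Zigzag2 d P (a, b) ab.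

End Zigzag2.

Section HibiVeronese.
Context (K : fieldType) (d : Order.disp_t) (P : finDistrLatticeType d).

Definition hibi2 := veronese2 (hibi_grading K P).
Definition hibi2_gr : nat -> {pred hibi2} := @veronese2_gr _ _ _ (hibi_grading K P).

Lemma hibi_prod2_veronese (z : zigzag2 P) :
  hibi_gen K (val z).1 * hibi_gen K (val z).2 \in veronese2_pred (hibi_gr K P).
Proof.
have h a : hibi_gen K a \in hibi_gr K P 1.
  by apply/asboolP; exists (hibi_var K a); rewrite ?dhomogX //; apply/eqP/mdeg1.
apply: (@gr_veronese2 _ _ _ (hibi_grading K P) 1).
by case: (hibi_grading K P) => _ _ hM _ _; apply: (hM 1%N 1%N).
Qed.

(* (a, b) in Z_2(P) is identified with the product ab. *)
Definition hibi2_vertex (z : zigzag2 P) : hibi2 :=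
  Veronese2 (hibi_grading K P) (hibi_prod2_veronese z).

End HibiVeronese.

Arguments hibi2 K {d} P.
Arguments hibi2_gr K {d} P i.
Arguments hibi2_vertex K {d P} z.

Lemma outer_le (d : Order.disp_t) (P : latticeType d) (a b c e : P) :
  (a <= b)%O -> (c <= e)%O -> (a `&` c <= b `|` e)%O.
Proof. by move=> ab _; rewrite (le_trans (leIl a c)) // (le_trans ab) // leUl. Qed.

Lemma inner_le (d : Order.disp_t) (P : latticeType d) (a b c e : P) :
  (a <= b)%O -> (c <= e)%O ->
  ((a `&` e) `|` (b `&` c) <= (a `|` e) `&` (b `|` c))%O.
Proof.
move=> ab ce; rewrite leUx !lexI; apply/andP; split; apply/andP; split.
- by rewrite (le_trans (leIl _ _)) // leUl.
- by rewrite (le_trans (leIl _ _)) // (le_trans ab) // leUl.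
- by rewrite (le_trans (leIr _ _)) // (le_trans ce) // leUr.
- by rewrite (le_trans (leIl _ _)) // leUl.
Qed.

(* Main.v *)
From HB Require Import structures.
Require Import Defs.
From mathcomp Require Import all_boot all_order all_algebra.
From mathcomp Require Import boolp mpoly.

Set Implicit Arguments.
Unset Strict Implicit.
Unset Printing Implicit Defensive.

Import Order.TTheory GRing.Theory.

Local Open Scope ring_scope.

(** The vertices of Z_2(P) are the intervals of P, and a <= b in Z_2(P) says
    that the interval a contains b.  A chain of n vertices is thus a nest
    [a_1, b_1], ..., [a_n, b_n] of intervals, and listing its endpoints in
    increasing order, a_1 <= ... <= a_n <= b_n <= ... <= b_1, gives a chain of
    length 2n in P with the same product in the Hibi ring A.  Every chain of
    even length of P arises from exactly one nest (pair its first element with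
    its last, and so on), so the standard monomials over Z_2(P) are exactly
    the standard monomials of even degree of A: they form a basis of A^(2) as
    soon as the standard monomials over P form a basis of A.

    That basis of A is Hibi's theorem, proved here in two halves.  The standard
    monomials span because x y = (x /\ y)(x \/ y) holds for all x and y, so
    that a new factor can be inserted into a chain by bubbling
    ([hibi_straighten]).  They are independent because A maps to a polynomial
    ring with one variable per join-prime z of P, sending a to the product of
    the variables z <= a: the relations go to 0, and distinct chains have
    distinct, hence independent, images ([hibi_independent]).

    The straightening law is obtained from three Hibi relations and the
    distributive law ([hibi_gen_quad]).  Its right-hand side is a standard
    monomial, hence the only standard expression of the product, and its first
    vertex is the smallest interval containing the two given ones, which is
    strictly below each of them in Z_2(P) when they are incomparable ([outer_lt]).  The remaining
    axioms of an algebra with straightening laws follow from the basis, except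
    for the grading, which is inherited from A. *)

(** * Bases of standard monomials *)

Lemma monomial_cons (K : fieldType) (d : Order.disp_t) (Q : finPOrderType d)
    (A : comAlgType K) (e : Q -> A) q s :
  monomial e (q :: s) = e q * monomial e s.
Proof. exact: big_cons. Qed.

Section StandardBasis.
Context (K : fieldType) (d : Order.disp_t) (Q : finPOrderType d).
Context (A : comAlgType K) (e : Q -> A).
Implicit Types (S T U : seq (seq Q)) (c b : seq Q -> K).

Definition standard_span (x : A) : Prop :=
  exists S c, [/\ uniq S, all (@standard _ Q) S & x = lincomb e S c].

Lemma lincomb_widen S U c : uniq S -> uniq U -> {subset S <= U} ->
  lincomb e S c = lincomb e U (fun s => if s \in S then c s else 0).
Proof.
move=> uS uU SU; rewrite /lincomb [RHS](bigID (mem S)) /=.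
rewrite [X in _ + X]big1 ?addr0 => [|s /negbTE ->]; last by rewrite scale0r.
rewrite -[RHS]big_filter (perm_big [seq s <- U | s \in S]) /=.
  by apply: eq_big_seq => s; rewrite mem_filter => /andP[->].
apply: uniq_perm; rewrite ?filter_uniq // => s.
by rewrite mem_filter; case: (boolP (s \in S)) => // /SU ->.
Qed.

Lemma lincomb_sum S T c b k : uniq S -> uniq T ->
  k *: lincomb e S c + lincomb e T b =
  lincomb e (undup (S ++ T)) (fun s => k * (if s \in S then c s else 0) +
                                      (if s \in T then b s else 0)).
Proof.
move=> uS uT; rewrite (@lincomb_widen S (undup (S ++ T))) ?undup_uniq //.
  rewrite (@lincomb_widen T (undup (S ++ T))) ?undup_uniq //.
    rewrite /lincomb scaler_sumr -big_split /=; apply: eq_bigr => s _.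
    by rewrite scalerDl scalerA.
  by move=> s sT; rewrite mem_undup mem_cat sT orbT.
by move=> s sS; rewrite mem_undup mem_cat sS.
Qed.

Lemma all_standard_undup S T : all (@standard _ Q) S -> all (@standard _ Q) T ->
  all (@standard _ Q) (undup (S ++ T)).
Proof.
move=> /allP stS /allP stT; apply/allP => s; rewrite mem_undup mem_cat.
by case/orP => [/stS|/stT].
Qed.

Lemma standard_span0 : standard_span 0.
Proof. by exists [::], (fun=> 0); rewrite /lincomb big_nil. Qed.

Lemma standard_span1 s : standard s -> standard_span (monomial e s).
Proof.
by move=> st; exists [:: s], (fun=> 1); rewrite /lincomb big_seq1 scale1r /= st.
Qed.

Lemma standard_spanD k x y :
  standard_span x -> standard_span y -> standard_span (k *: x + y).
Proof.
move=> [S [c [uS stS ->]]] [T [b [uT stT ->]]].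
do 2!eexists; split; last exact: lincomb_sum.
  exact: undup_uniq.
exact: all_standard_undup.
Qed.

Hypothesis basis : standard_monomials_basis e.

(** By independence, all standard expressions of x have the same monomials; this
    makes one explicit expression enough to check a condition on all of them. *)
Lemma standard_expression_sub x S c T b :
    standard_expression e x S c -> standard_expression e x T b ->
  {subset S <= T}.
Proof.
move=> [uS stS c0 ->] [uT stT _ eqx] s sS.
have /basis.2 : lincomb e (undup (T ++ S)) (fun s =>
    (-1) * (if s \in T then b s else 0) + (if s \in S then c s else 0)) = 0.
  by rewrite -lincomb_sum // eqx scaleN1r addNr.
move=> /(_ (undup_uniq _) (all_standard_undup stT stS) s).
rewrite mem_undup mem_cat sS orbT => /(_ isT).
case: (boolP (s \in T)) => // _; rewrite mulr0 add0r => /eqP.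
by rewrite (negbTE (c0 s sS)).
Qed.

Lemma standard_expression1 s :
  standard s -> standard_expression e (monomial e s) [:: s] (fun=> 1).
Proof.
move=> st; split=> //=; first by rewrite st.
- by move=> i _; rewrite oner_neq0.
- by rewrite /lincomb big_seq1 scale1r.
Qed.

Lemma standard_basis_inj : injective e.
Proof.
move=> x y exy.
have h z : standard_expression e (e z) [:: [:: z]] (fun=> 1).
  by have:= @standard_expression1 [:: z] isT; rewrite /monomial big_seq1.
have := h x; rewrite exy => /standard_expression_sub/(_ (h y))/(_ _ (mem_head _ _)).
by rewrite inE => /eqP[].
Qed.

Lemma standard_basis_generate (B : {pred A}) :
  subalg_closed B -> (forall q, e q \in B) -> forall x, x \in B.
Proof.
move=> Bsub eB x; have [S [c [_ _ ->]]] := basis.1 x.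
have [B1 Blin BM] := Bsub.
have B0 : 0 \in B by rewrite -[0](addNr 1) -scaleN1r Blin.
rewrite /lincomb; elim/big_ind: _ => // [u v uB vB|s _].
  by rewrite -[u]scale1r Blin.
rewrite -[_ *: _]addr0 Blin //; rewrite /monomial.
by elim/big_ind: _ => // u v; apply: BM.
Qed.

End StandardBasis.

(** * The grading of the Veronese algebra *)

(** Independence of the components is inherited by viewing a sum over i of
    terms of degree 2i in A as a sum over all degrees. *)
Lemma veronese2_grading (K : fieldType) (A : comAlgType K) (gr : nat -> {pred A})
    (gr_grading : is_grading gr) : is_grading (@veronese2_gr K A gr gr_grading).
Proof.
have [gsub g1 gM gdec gindep] := gr_grading; split.
- move=> i; split; first exact: (gr_0 gr_grading).
  by move=> k x y xi yi; apply: (gr_scaleD gr_grading).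
- exact: g1.
- by move=> i j x y xi yi; rewrite /veronese2_gr unfold_in mulnDr; apply: gM.
- move=> x; have /asboolP[n [f [fg xE]]] := valP x.
  exists n, (fun i => Veronese2 gr_grading (gr_veronese2 gr_grading (fg i))).
  split=> [i|]; first exact: fg.
  by apply: val_inj; rewrite raddf_sum.
- move=> n f fg sum0.
  (* The family is interleaved with zeros, which fill the odd degrees. *)
  pose g j : A := if odd j then 0 else val (f j./2).
  have gg j : g j \in gr j.
    rewrite /g; case: ifP => [_|/negbT jev]; first exact: (gr_0 gr_grading).
    by rewrite -[X in gr X](even_halfK jev) -mul2n; apply: fg.
  have : \sum_(j < 2 * n) g j = 0.
    have : val (\sum_(i < n) f i) = 0 by rewrite sum0 raddf0.
    rewrite raddf_sum => {2}<-; elim: n {sum0} => [|n IHn]; first by rewrite !big_ord0.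
    rewrite mulnS !big_ord_recr /= IHn /g /= mul2n odd_double /= addr0.
    by rewrite doubleK.
  move=> /(gindep _ _ gg) g0 i lt_in; apply: val_inj.
  have := g0 (2 * i)%N; rewrite ltn_pmul2l // => /(_ lt_in).
  by rewrite /g mul2n odd_double doubleK => ->; rewrite raddf0.
Qed.

(** * Join-primes of a finite distributive lattice *)

Section JoinPrime.
Context (d : Order.disp_t) (P : finDistrLatticeType d).
Implicit Types (a b x y z : P) (s t : seq P).

(** Only binary joins are tested, so that the least element counts as
    join-prime: being below every element, it makes the toric map remember the
    degree. *)
Definition join_prime z : bool :=
  [forall a, forall b, (z <= a `|` b)%O ==> (z <= a)%O || (z <= b)%O].

Lemma join_primeP z a b :
  join_prime z -> (z <= a `|` b)%O = (z <= a)%O || (z <= b)%O.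
Proof.
move=> /forallP/(_ a)/forallP/(_ b)/implyP zab; apply/idP/idP => // /orP[] h.
  exact: lexUl.
exact: lexUr.
Qed.

Lemma join_prime_bot z : (forall x, (z <= x)%O) -> join_prime z.
Proof. by move=> zmin; apply/forallP=> a; apply/forallP=> b; rewrite !zmin. Qed.

(** Elements of P are determined by the join-primes below them: if x is not below
    y, a minimal z that is below x but not below y is join-prime.  Indeed,
    if z <= a \/ b with z below neither a nor b, then by distributivity z is the
    join of z /\ a and z /\ b, which are smaller than z, hence below y. *)
Lemma join_prime_sep x y :
  (forall z, join_prime z -> (z <= x)%O -> (z <= y)%O) -> (x <= y)%O.
Proof.
move=> xy; apply: contraT => nxy.
pose bad z := (z <= x)%O && ~~ (z <= y)%O.
have badx : bad x by rewrite /bad lexx.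
have [z /andP[zx nzy] zmin] :
    {z | bad z & forall z', bad z' -> (#|[set u | (u <= z)%O]| <= #|[set u | (u <= z')%O]|)%N}.
  by case: (arg_minnP (fun z => #|[set u | (u <= z)%O]|) badx) => z; exists z.
have below u : (u < z)%O -> (u <= y)%O.
  move=> uz; apply: contraT => nuy.
  have /zmin : bad u by rewrite /bad nuy (le_trans (ltW uz) zx).
  rewrite leqNgt proper_card //; apply/properP; split.
    by apply/subsetP => v; rewrite !inE => /le_trans; apply; apply: ltW.
  by exists z; rewrite !inE ?lexx // lt_geF.
have zj : join_prime z.
  apply/forallP => a; apply/forallP => b; apply/implyP => zab.
  apply: contraR nzy; rewrite negb_or => /andP[nza nzb].
  rewrite -(meet_l zab) meetUr leUx !below //.
  - by rewrite lt_neqAle leIl eq_meetl nzb.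
  - by rewrite lt_neqAle leIl eq_meetl nza.
by rewrite (xy z zj zx) in nzy.
Qed.

Lemma standard_cons x s : standard (x :: s) = all (fun y => x <= y)%O s && standard s.
Proof. by rewrite /standard !(sorted_pairwise le_trans) pairwise_cons. Qed.

Lemma lower_boundP x s : exists z, all (fun y => z <= y)%O (x :: s).
Proof.
elim: s => [|y s [z /=/andP[zx zs]]]; first by exists x; rewrite /= lexx.
exists (z `&` y)%O; rewrite /= leIr leIxl //=.
by apply: sub_all zs => u zu; apply: leIxl.
Qed.

(** In a chain x <= ..., every member is above z exactly when x is, so
    the counts tell which join-primes lie below the first element; hence they
    determine it, and by induction the whole chain.  The count for the least
    element of P gives the length. *)
Lemma standard_count_inj s t : standard s -> standard t ->
    (forall z, join_prime z ->
       count (fun x => z <= x)%O s = count (fun x => z <= x)%O t) ->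
  s = t.
Proof.
move=> sts stt eqc.
have size_eq : size s = size t.
  case: (pickP (fun _ : P => true)) => [x0 _|P0]; last first.
    have size0 (r : seq P) : size r = 0%N by case: r => // x r; have := P0 x.
    by rewrite !size0.
  have [z /andP[_ /allP zmin]] := lower_boundP x0 (enum P).
  have zle x : (z <= x)%O by apply: zmin; rewrite mem_enum.
  by have := eqc z (join_prime_bot zle); rewrite !(eq_count zle) !count_predT.
elim: s t sts stt eqc size_eq => [|x s IHs] [|y t] //.
rewrite !standard_cons => /andP[xs sts] /andP[yt stt] eqc [size_eq].
have head_le z u r : all (fun y => u <= y)%O r ->
    (z <= u)%O = (count (fun x => z <= x)%O (u :: r) == (size r).+1).
  move=> ur; rewrite -[(size r).+1]/(size (u :: r)) -all_count /=.
  apply/idP/andP => [zu|[]//]; split=> //.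
  by apply: sub_all ur => v; apply: le_trans.
have exy : x = y.
  apply: le_anti; apply/andP; split; apply: join_prime_sep => z zj;
    by rewrite (head_le z _ _ xs) (head_le z _ _ yt) eqc // size_eq.
rewrite exy (IHs t) // => z zj; have := eqc z zj.
by rewrite /= exy => /addnI.
Qed.

(** This identity is what sends the Hibi relations to 0 in the toric map. *)
Lemma join_prime_valuation z a b : join_prime z ->
  ((z <= a)%O + (z <= b)%O)%N = ((z <= a `&` b)%O + (z <= a `|` b)%O)%N.
Proof. by move=> zj; rewrite join_primeP // lexI; do 2!case: (_ <= _)%O. Qed.

End JoinPrime.

(** * Standard monomials form a basis of the Hibi ring *)

Section HibiBasis.
Context (K : fieldType) (d : Order.disp_t) (P : finDistrLatticeType d).
Implicit Types (a b x y z : P) (s t : seq P).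

Local Notation S := {mpoly K[#|P|]}.

Lemma hibi_genM x y :
  hibi_gen K x * hibi_gen K y = hibi_gen K (x `&` y)%O * hibi_gen K (x `|` y)%O.
Proof.
case: (boolP (x >=< y)%O) => [|nxy].
  case/orP => h; first by rewrite (meet_l h) (join_r h).
  by rewrite (meet_r h) (join_l h) mulrC.
apply/eqP; rewrite -subr_eq0 -!rmorphM -rmorphB hibi_pi_eq0.
apply/asboolP; exists (fun a b => ((a == x) && (b == y))%:R).
rewrite (bigD1 x) //= (bigD1 y) //= !eqxx mul1r.
rewrite big1 => [|b /andP[_ /negbTE->]]; last by rewrite mul0r.
rewrite big1 ?addr0 // => a /negbTE->.
by rewrite big1 // => b _; rewrite mul0r.
Qed.

(** x y = (x /\ y)(x \/ y) puts x /\ y in front, and x \/ y is inserted in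
    turn into the rest.  The clause on lower bounds is needed by the induction,
    to see that x /\ y stays below the new tail. *)
Lemma hibi_insert x s : standard s ->
  exists t, [/\ standard t, size t = (size s).+1,
                forall z, all (fun y => z <= y)%O (x :: s) -> all (fun y => z <= y)%O t
              & hibi_gen K x * monomial (hibi_gen K) s = monomial (hibi_gen K) t].
Proof.
elim: s x => [|y s IHs] x; first by exists [:: x]; rewrite monomial_cons.
rewrite standard_cons => /andP[ys sts].
have [t [stt szt tle tE]] := IHs (x `|` y)%O sts.
exists ((x `&` y)%O :: t); split; rewrite ?[size _]/= ?szt //.
- rewrite standard_cons stt andbT tle //= leIxl ?leUl //=.
  by apply: sub_all ys => u yu; apply: leIxr.
- move=> z /and3P[zx zy zs]; rewrite /= lexI zx zy tle //=.
  by apply/andP; split=> //; apply: lexUl.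
- by rewrite !monomial_cons -tE !mulrA hibi_genM.
Qed.

Lemma hibi_straighten s :
  exists t, [/\ standard t, size t = size s
              & monomial (hibi_gen K) s = monomial (hibi_gen K) t].
Proof.
elim: s => [|x s [t [stt szt tE]]]; first by exists [::].
have [u [stu szu _ uE]] := hibi_insert x stt.
by exists u; rewrite szu szt monomial_cons tE.
Qed.

Lemma mpolyX_hibi_var (m : 'X_{1..#|P|}) :
  exists2 s : seq P, size s = mdeg m & 'X_[K, m] = monomial (@hibi_var K d P) s.
Proof.
exists (flatten [seq nseq (m i) (enum_val i) | i <- enum 'I_#|P|]).
  rewrite size_flatten /shape -map_comp sumnE big_map mdegE -big_enum.
  by apply: eq_bigr => i _; rewrite /= size_nseq.
rewrite /monomial big_flatten big_map mpolyXE_id -big_enum.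
apply: eq_bigr => i _ /=; rewrite big_nseq iter_mulr_1.
by rewrite /hibi_var enum_valK.
Qed.

Lemma hibi_pi_monomial s :
  hibi_pi (monomial (@hibi_var K d P) s) = monomial (hibi_gen K) s.
Proof. by rewrite /monomial rmorph_prod. Qed.

Definition toric_exponent a : 'X_{1..#|P|} :=
  [multinom (join_prime (enum_val i) && (enum_val i <= a)%O : nat) | i < #|P|].

(** Hibi's toric realization of the ring, defined on the polynomial ring before
    passing to the quotient: a goes to the product of the variables indexed by
    the join-primes z <= a. *)
Definition toric_map (p : S) : S :=
  p \mPo [tuple 'X_[K, toric_exponent (enum_val i)] | i < #|P|].

HB.instance Definition _ := GRing.LRMorphism.copy toric_map
  (comp_mpoly [tuple 'X_[K, toric_exponent (enum_val i)] | i < #|P|]).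

Lemma toric_map_var a : toric_map (hibi_var K a) = 'X_[toric_exponent a].
Proof.
by rewrite /toric_map comp_mpolyXU -tnth_nth tnth_mktuple enum_rankK.
Qed.

Lemma toric_map_monomial s :
  toric_map (monomial (@hibi_var K d P) s) = 'X_[\sum_(a <- s) toric_exponent a].
Proof.
rewrite /monomial rmorph_prod /= -[X in mpolyX _ X](big_map _ xpredT id).
rewrite -mpolyX_prod big_map.
by apply: eq_bigr => a _; apply: toric_map_var.
Qed.

Lemma toric_map_ideal p : p \in @hibi_ideal K d P -> toric_map p = 0.
Proof.
move=> /asboolP[c ->]; rewrite raddf_sum big1 // => a _.
rewrite raddf_sum big1 // => b _.
rewrite /= rmorphM /= rmorphB /= !rmorphM /= !toric_map_var -!mpolyXD.
suff -> : (toric_exponent a + toric_exponent b =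
    toric_exponent (a `&` b)%O + toric_exponent (a `|` b)%O)%MM.
  by rewrite subrr mulr0.
apply/mnmP => i; rewrite !mnmDE !mnmE.
by case: (boolP (join_prime _)) => //= zj; apply: join_prime_valuation.
Qed.

Lemma toric_exponent_inj s t : standard s -> standard t ->
  (\sum_(a <- s) toric_exponent a = \sum_(a <- t) toric_exponent a)%MM -> s = t.
Proof.
move=> sts stt eqst; apply: standard_count_inj => // z zj.
have countE r : (\sum_(a <- r) toric_exponent a)%MM (enum_rank z) =
    count (fun x => z <= x)%O r.
  rewrite mnm_sumE -sum1_count [RHS]big_mkcond; apply: eq_bigr => a _.
  by rewrite mnmE enum_rankK zj /=; case: (z <= a)%O.
by rewrite -!countE eqst.
Qed.

(** The index u lets the lemma apply to sums that run over chains of Z_2(P). *)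
Lemma hibi_independent (T : eqType) (I : seq T) (u : T -> seq P) (c : T -> K) :
    uniq I -> {in I &, injective u} -> {in I, forall i, standard (u i)} ->
    \sum_(i <- I) c i *: monomial (hibi_gen K) (u i) = 0 ->
  {in I, forall i, c i = 0}.
Proof.
move=> uI injI stI sum0 i iI.
pose p : S := \sum_(i <- I) c i *: monomial (@hibi_var K d P) (u i).
have /toric_map_ideal : p \in @hibi_ideal K d P.
  rewrite -hibi_pi_eq0 -[X in _ == X]sum0 raddf_sum; apply/eqP.
  by apply: eq_bigr => j _; rewrite /= hibi_piZ hibi_pi_monomial.
rewrite raddf_sum => /(congr1 (mcoeff (\sum_(a <- u i) toric_exponent a)%MM)).
rewrite mcoeff0 raddf_sum (bigD1_seq i) //= [toric_map _]linearZ /=.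
rewrite toric_map_monomial mcoeffZ mcoeffX eqxx mulr1 big_seq_cond big1 ?addr0 //.
move=> j /andP[jI nji]; rewrite linearZ /= toric_map_monomial mcoeffZ mcoeffX.
case: eqP => [uji|_]; last by rewrite mulr0.
case/eqP: nji; apply: injI => //.
by apply: toric_exponent_inj uji; apply: stI.
Qed.

End HibiBasis.

(** * Nested intervals and chains of even length *)

Section Nested.
Context (d : Order.disp_t) (P : finPOrderType d).
Implicit Types (z : zigzag2 P) (w : seq (zigzag2 P)) (s : seq P).

(** For a chain of intervals, nested by the order of Z_2(P), this lists the
    endpoints in increasing order: left ones going in, right ones coming out. *)
Fixpoint endpoints w : seq P :=
  if w is z :: w' then (val z).1 :: rcons (endpoints w') (val z).2 else [::].

Lemma endpoints_inj : injective endpoints.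
Proof.
elim=> [|z w IHw] [|z' w'] //= [e1 /rcons_inj[/IHw <- e2]].
congr (_ :: _); apply: val_inj.
by case: z z' e1 e2 => [[? ?] ?] [[? ?] ?] /= -> ->.
Qed.

(** Since (val q).1 <= (val q).2, an interval q lies inside z exactly when both
    of its endpoints lie between those of z. *)
Lemma all_endpoints z w :
  all (fun q => z <= q)%O w =
  all (fun x => (val z).1 <= x)%O (endpoints w) &&
  all (fun x => x <= (val z).2)%O (endpoints w).
Proof.
elim: w => //= q w ->; rewrite !all_rcons.
rewrite [(z <= q)%O]/(zle z q) /zle; have qle := zigzag2_le q.
have [zq1|] := boolP ((val z).1 <= (val q).1)%O => //=.
have [zq2|] := boolP ((val q).2 <= (val z).2)%O; rewrite ?andbF //=.
by rewrite (le_trans zq1 qle) (le_trans qle zq2).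
Qed.

Lemma standard_endpoints w : standard (endpoints w) = standard w.
Proof.
rewrite /standard !(sorted_pairwise le_trans).
elim: w => //= z w IHw; rewrite pairwise_rcons IHw all_rcons all_endpoints.
by rewrite (zigzag2_le z) /= !andbA.
Qed.

Lemma endpoints_surj n s : standard s -> size s = (2 * n)%N ->
  exists w, s = endpoints w.
Proof.
rewrite /standard (sorted_pairwise le_trans).
elim: n s => [|n IHn] s sts szs; first by case: s szs {sts} => // _; exists [::].
case: s sts szs => [|a s]; first by rewrite mulnS.
case/lastP: s => [|s b]; first by rewrite mulnS; case: n {IHn}.
rewrite /= pairwise_rcons all_rcons size_rcons mulnS.
move=> /andP[/andP[ab _] /andP[_ sts]] [/(IHn _ sts)[w ->]].
by exists (zz ab :: w).
Qed.

End Nested.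

(** * The second Veronese algebra of the Hibi ring *)

Section HibiVeroneseBasis.
Context (K : fieldType) (d : Order.disp_t) (P : finDistrLatticeType d).
Implicit Types (w : seq (zigzag2 P)) (s : seq P) (x : hibi2 K P).

Lemma hibi2_valZ k x : val (k *: x) = k *: val x.
Proof. exact: linearZ. Qed.

Lemma val_monomial w :
  val (monomial (hibi2_vertex K (P := P)) w) =
  monomial (hibi_gen K) (endpoints w).
Proof.
elim: w => [|z w IHw]; first by rewrite /monomial !big_nil rmorph1.
rewrite monomial_cons rmorphM /= [X in _ * X]IHw monomial_cons.
by rewrite {2}/monomial big_rcons /= mulrA mulrAC -mulrA.
Qed.

(** A homogeneous element of degree 2i of A is a combination of monomials of
    size 2i; straightening keeps the size, so that each of the resulting
    chains is the list of endpoints of a nest of intervals. *)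
Lemma hibi2_standard_span x : standard_span (hibi2_vertex K (P := P)) x.
Proof.
have /asboolP[n [f [fg xE]]] := valP x.
have -> : x = \sum_(i < n) Veronese2 (hibi_grading K P)
    (gr_veronese2 (hibi_grading K P) (fg i)).
  by apply: val_inj; rewrite raddf_sum.
elim/big_ind: _ => [|u v|i _]; [exact: standard_span0| |].
  by rewrite -[u in u + v]scale1r; apply: standard_spanD.
have /asboolP[p /dhomogP hp fE] := fg i.
have /choice[w hw] (m : 'X_{1..#|P|}) : exists w, m \in msupp p ->
    standard w /\ hibi_pi 'X_[K, m] = monomial (hibi_gen K) (endpoints w).
  case: (boolP (m \in msupp p)) => [/hp mdegm|]; last by exists [::].
  have [t szt ->] := mpolyX_hibi_var K m.
  have [s [sts szs sE]] := hibi_straighten K t.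
  have [|w sw] := @endpoints_surj _ _ i s sts; first by rewrite szs szt.
  exists w => _; rewrite -standard_endpoints -sw; split=> //.
  by rewrite hibi_pi_monomial.
set y := Veronese2 _ _.
have -> : y = \sum_(m <- msupp p) p@_m *: monomial (hibi2_vertex K (P := P)) (w m).
  apply: val_inj; rewrite [LHS]/= fE {1}[p]mpolyE !raddf_sum /=.
  apply: eq_big_seq => m mp; rewrite hibi_piZ [RHS]hibi2_valZ val_monomial.
  by have [_ ->] := hw m mp.
rewrite big_seq; elim/big_ind: _ => [|u v|m /hw[stw _]]; [exact: standard_span0| |].
  by rewrite -[u in u + v]scale1r; apply: standard_spanD.
rewrite -[_ *: _]addr0; apply: standard_spanD (standard_span0 _).
exact: standard_span1.
Qed.

Lemma hibi2_basis : standard_monomials_basis (hibi2_vertex K (P := P)).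
Proof.
split; first exact: hibi2_standard_span.
move=> S c uS /allP stS /(congr1 val); rewrite raddf_sum raddf0 => sum0.
apply: (@hibi_independent K _ P _ S (@endpoints _ P) c) => //.
- by move=> w w' _ _; apply: endpoints_inj.
- by move=> w wS; rewrite standard_endpoints stS.
rewrite -[RHS]sum0; apply: eq_bigr => w _.
by rewrite [RHS]hibi2_valZ val_monomial.
Qed.

(** The products ac and be produce the outer pair and the middle pair a \/ c,
    b /\ e.  A third relation straightens this pair, and distributivity together
    with a <= b and c <= e brings the result to the symmetric form. *)
Lemma hibi_gen_quad (a b c e : P) : (a <= b)%O -> (c <= e)%O ->
  hibi_gen K a * hibi_gen K b * (hibi_gen K c * hibi_gen K e) =
  hibi_gen K (a `&` c)%O * hibi_gen K (b `|` e)%O *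
  (hibi_gen K ((a `&` e) `|` (b `&` c))%O * hibi_gen K ((a `|` e) `&` (b `|` c))%O).
Proof.
move=> ab ce.
have meetE : ((a `|` c) `&` (b `&` e) = (a `&` e) `|` (b `&` c))%O.
  by rewrite meetUl meetA (meet_l ab) [(c `&` _)%O]meetC -meetA (meet_r ce).
have joinE : ((a `|` c) `|` (b `&` e) = (a `|` e) `&` (b `|` c))%O.
  rewrite joinIr -!joinA [(c `|` b)%O]joinC (join_r ce) joinA (join_r ab).
  exact: meetC.
rewrite mulrACA (hibi_genM K a c) (hibi_genM K b e).
rewrite [X in _ * X]mulrC mulrACA [X in _ * X]hibi_genM.
by rewrite meetE joinE.
Qed.

Lemma hibi2_vertexM (a b c e : P) (ab : (a <= b)%O) (ce : (c <= e)%O) :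
  hibi2_vertex K (zz ab) * hibi2_vertex K (zz ce) =
  monomial (hibi2_vertex K (P := P)) [:: zz (outer_le ab ce); zz (inner_le ab ce)].
Proof.
rewrite !monomial_cons /monomial big_nil mulr1.
by apply: val_inj; rewrite !rmorphM; apply: hibi_gen_quad.
Qed.

Lemma standard_outer_inner (a b c e : P) (ab : (a <= b)%O) (ce : (c <= e)%O) :
  standard [:: zz (outer_le ab ce); zz (inner_le ab ce)].
Proof.
rewrite /standard /= andbT [(_ <= _)%O]/(zle _ _) /zle /=.
by rewrite lexUl ?leI2 // leIxl ?leU2.
Qed.

Lemma outer_lt (a b c e : P) (ab : (a <= b)%O) (ce : (c <= e)%O) :
  ~~ (zz ab >=< zz ce)%O ->
  (zz (outer_le ab ce) < zz ab)%O /\ (zz (outer_le ab ce) < zz ce)%O.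
Proof.
move=> inc.
have oab : (zz (outer_le ab ce) <= zz ab)%O.
  by rewrite [(_ <= _)%O]/(zle _ _) /zle /= leIl leUl.
have oce : (zz (outer_le ab ce) <= zz ce)%O.
  by rewrite [(_ <= _)%O]/(zle _ _) /zle /= leIr leUr.
rewrite !lt_neqAle oab oce !andbT; split; apply: contraNneq inc => <-.
  by rewrite /Order.comparable oce.
by rewrite /Order.comparable oab orbT.
Qed.

Lemma hibi2_straightening (a b c e : P) (ab : (a <= b)%O) (ce : (c <= e)%O) :
  standard_expression (hibi2_vertex K (P := P))
    (hibi2_vertex K (zz ab) * hibi2_vertex K (zz ce))
    [:: [:: zz (outer_le ab ce); zz (inner_le ab ce)]] (fun=> 1).
Proof.
rewrite hibi2_vertexM; apply: standard_expression1.
exact: standard_outer_inner.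
Qed.

Lemma hibi2_gr0 x : x \in hibi2_gr K P 0 <-> exists k : K, x = k%:A.
Proof.
have [gsub g1 _ _ _] := veronese2_grading (hibi_grading K P).
split=> [/asboolP[p /dhomogP ph0 xE]|[k ->]]; last first.
  by have [g0 gZ] := gsub 0%N; rewrite -[k%:A]addr0; apply: gZ.
exists p@_0%MM; apply: val_inj; rewrite [LHS]xE.
rewrite [RHS]hibi2_valZ rmorph1 -[1](rmorph1 (@hibi_pi K d P)) -hibi_piZ.
congr hibi_pi; apply/mpolyP => m; rewrite mcoeffZ mcoeff1.
case: eqP => [->|/eqP m0]; rewrite ?mulr1 // mulr0.
by apply/eqP; apply: contraR m0; rewrite -mcoeff_msupp => /ph0/eqP; rewrite mdeg_eq0.
Qed.

Lemma hibi2_vertex_gr (z : zigzag2 P) : hibi2_vertex K z \in hibi2_gr K P 1.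
Proof.
have [_ _ gM _ _] := hibi_grading K P.
have genP a : hibi_gen K a \in hibi_gr K P 1.
  by apply/asboolP; exists (hibi_var K a); rewrite ?dhomogX //; apply/eqP/mdeg1.
exact: (gM 1%N 1%N).
Qed.

End HibiVeroneseBasis.

Theorem theorem3p3 (K : fieldType) (d : Order.disp_t)
    (P : finDistrLatticeType d) :
  [/\ is_ASL (hibi2_gr K P) (hibi2_vertex K (P := P)),
      forall x : hibi2 K P,
        (exists z : zigzag2 P, x = hibi2_vertex K z) <->
        (exists s : seq P, [/\ standard s, size s = 2%N
                             & val x = monomial (hibi_gen K) s])
    & forall (a b c e : P) (ab : (a <= b)%O) (ce : (c <= e)%O),
        ~~ (zz ab >=< zz ce)%O ->
        straightening_law (hibi2_vertex K (P := P)) (zz ab) (zz ce)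
          [:: [:: zz (outer_le ab ce); zz (inner_le ab ce)]] (fun=> 1)].
Proof.
have basis := hibi2_basis K P; split.
- split; [exact: standard_basis_inj basis| |exact: basis|].
    split; [exact: veronese2_grading|exact: hibi2_gr0| |].
      by move=> z; exists 1%N => //; apply: hibi2_vertex_gr.
    exact: standard_basis_generate.
  move=> [[a b] ab] [[c e] ce] inc S f sexp s sS.
  have := standard_expression_sub basis sexp (hibi2_straightening K ab ce) sS.
  rewrite inE => /eqP->.
  by have [oab oce] := outer_lt inc; do 2!eexists; split.
- move=> x; split=> [[[[a b] ab] ->]|[s [sts szs xE]]].
    exists [:: a; b]; split=> //; first by rewrite /standard /= andbT.
    by rewrite /monomial !big_cons big_nil mulr1.
  case: s sts szs xE => [|a [|b []]] // + _ xE.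
  rewrite /standard /= andbT => ab; exists (zz ab); apply: val_inj.
  by rewrite xE /monomial !big_cons big_nil mulr1.
- by move=> a b c e ab ce inc; split=> //; apply: hibi2_straightening.
Qed.
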